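(* Let $I$ be a nonzero proper ideal in a Noetherian ring $S$. Suppose that $\mathcal{R}_s(I)=S[It,I^{(n)}t^n]$ for some $n\ge2$, and that there exists an ideal $P$ of $S$ such that $PI^{(n)}\subset I^n$ and $I^{(n)}\subset P^kI^{n-1}$ for some integer $k\ge1$. Then $I^{(nkq+nq)}\subset I^{nkq+nq-q}$ for all $q\in\mathbb{N}$, and $\displaystyle\rho(I)\le\frac{nk+n}{nk+n-1}$.
   Context: For an ideal $I$ in a Noetherian ring $S$, the $s$-th symbolic power is $I^{(s)}=\bigcap_{P\in\mathrm{Ass}(I)}(I^sS_P\cap S)$. The symbolic Rees algebra is $\mathcal{R}_s(I)=\bigoplus_{m\ge0}I^{(m)}t^m\subset S[t]$; $S[It,I^{(n)}t^n]$ denotes the $S$-subalgebra of $S[t]$ generated by all $at$ with $a\in I$ and all $bt^n$ with $b\in I^{(n)}$. The resurgence is $\rho(I)=\sup\{s/t : s,t\in\mathbb{N},\ I^{(s)}\not\subset I^t\}$, where $\mathbb{N}$ denotes the positive integers. *)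

(* Defs.v *)
From HB Require Import structures.
From mathcomp Require Import all_boot all_order all_algebra.
From mathcomp Require Import ring.
From mathcomp Require Import all_classical all_reals ereal.

Set Implicit Arguments.
Unset Strict Implicit.
Unset Printing Implicit Defensive.

Import Order.TTheory GRing.Theory Num.Theory.
Local Open Scope classical_set_scope.
Local Open Scope ring_scope.
Local Open Scope quotient_scope.

(* Localization M^-1 R of a commutative ring at a multiplicative subset:
   pairs (x, u) with u in M, modulo (x, u) ~ (y, v) iff w (x v - y u) = 0 for
   some w in M. MathComp only has the fraction field of an integral domain. *)
Module Localization.
Section Localization.
Variables (R : comNzRingType) (M : mulrClosed R).

Definition pre : Type := {p : R * R | p.2 \in M}.
HB.instance Definition _ := Choice.on pre.
Implicit Types x y z : pre.

Local Notation num x := (val x).1.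
Local Notation den x := (val x).2.

Lemma denP x : den x \in M. Proof. exact: valP x. Qed.

Lemma denM x y : den x * den y \in M.
Proof. by rewrite rpredM ?denP. Qed.

Definition frac (a u : R) (uM : u \in M) : pre :=
  exist (fun p : R * R => p.2 \in M) (a, u) uM.

Definition equiv x y : bool :=
  `[< exists2 w, w \in M & w * (num x * den y) = w * (num y * den x) >].

Lemma equiv_refl : reflexive equiv.
Proof. by move=> x; apply/asboolP; exists 1; rewrite ?rpred1. Qed.

Lemma equiv_sym : symmetric equiv.
Proof. by move=> x y; apply/asboolP/asboolP => -[w wM e]; exists w. Qed.

Lemma equiv_trans : transitive equiv.
Proof.
move=> y x z /asboolP[w wM e] /asboolP[w' w'M e']; apply/asboolP.
exists (w * w' * den y); first by rewrite !rpredM ?denP.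
transitivity (w' * den z * (w * (num x * den y))); first by ring.
rewrite e; transitivity (w * den x * (w' * (num y * den z))); first by ring.
by rewrite e'; ring.
Qed.

Canonical equiv_equiv := EquivRel equiv equiv_refl equiv_sym equiv_trans.

Definition type := {eq_quot equiv}.
HB.instance Definition _ : EqQuotient _ equiv type := EqQuotient.on type.
HB.instance Definition _ := Choice.on type.

Lemma equivP x y : reflect
  (exists2 w, w \in M & w * (num x * den y) = w * (num y * den x))
  (x == y %[mod type]).
Proof. by rewrite eqmodE; apply: asboolP. Qed.

Lemma equiv_repr x :
  exists2 w, w \in M & w * (num x * den (repr (\pi_type x)))
                     = w * (num (repr (\pi_type x)) * den x).
Proof. by apply/equivP; rewrite reprK. Qed.

Definition addf x y : pre :=
  frac (num x * den y + num y * den x) (denM x y).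
Definition add := lift_op2 type addf.

Lemma pi_add : {morph \pi : x y / addf x y >-> add x y}.
Proof.
move=> x y; unlock add; apply/eqP/equivP => /=.
have [w wM e] := equiv_repr x; have [w' w'M e'] := equiv_repr y.
move: (repr _) (repr _) e e' => y' x' e e'.
exists (w * w'); first exact: rpredM.
transitivity (w' * den y * den y' * (w * (num x * den x'))
  + w * den x * den x' * (w' * (num y * den y'))); first by ring.
by rewrite e e'; ring.
Qed.
Canonical pi_add_morph := PiMorph2 pi_add.

Definition oppf x : pre := frac (- num x) (denP x).
Definition opp := lift_op1 type oppf.

Lemma pi_opp : {morph \pi : x / oppf x >-> opp x}.
Proof.
move=> x; unlock opp; apply/eqP/equivP => /=.
by have [w wM e] := equiv_repr x; exists w; rewrite // !mulNr !mulrN e.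
Qed.
Canonical pi_opp_morph := PiMorph1 pi_opp.

Definition mulf x y : pre :=
  frac (num x * num y) (denM x y).
Definition mul := lift_op2 type mulf.

Lemma pi_mul : {morph \pi : x y / mulf x y >-> mul x y}.
Proof.
move=> x y; unlock mul; apply/eqP/equivP => /=.
have [w wM e] := equiv_repr x; have [w' w'M e'] := equiv_repr y.
move: (repr _) (repr _) e e' => y' x' e e'.
exists (w * w'); first exact: rpredM.
transitivity (w * (num x * den x') * (w' * (num y * den y'))); first by ring.
by rewrite e e'; ring.
Qed.
Canonical pi_mul_morph := PiMorph2 pi_mul.

Definition toloc := lift_embed type (fun a : R => frac a (rpred1 M)).
Canonical toloc_pi_morph := PiEmbed toloc.

Let eq_pi x y : num x * den y = num y * den x -> \pi_type x = \pi_type y.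
Proof.
by move=> e; apply/eqP/equivP; exists 1; rewrite ?rpred1 // !mul1r.
Qed.

Lemma addA : associative add.
Proof.
elim/quotW=> x; elim/quotW=> y; elim/quotW=> z; rewrite !piE.
by apply: eq_pi => /=; ring.
Qed.

Lemma addC : commutative add.
Proof.
elim/quotW=> x; elim/quotW=> y; rewrite !piE.
by apply: eq_pi => /=; ring.
Qed.

Lemma add0_l : left_id (toloc 0) add.
Proof.
by elim/quotW=> x; rewrite !piE; apply: eq_pi => /=; ring.
Qed.

Lemma addN_l : left_inverse (toloc 0) opp add.
Proof.
by elim/quotW=> x; rewrite !piE; apply: eq_pi => /=; ring.
Qed.

HB.instance Definition _ := GRing.isZmodule.Build type addA addC add0_l addN_l.

Lemma mulA : associative mul.
Proof.
elim/quotW=> x; elim/quotW=> y; elim/quotW=> z; rewrite !piE.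
by apply: eq_pi => /=; ring.
Qed.

Lemma mulC : commutative mul.
Proof.
elim/quotW=> x; elim/quotW=> y; rewrite !piE.
by apply: eq_pi => /=; ring.
Qed.

Lemma mul1_l : left_id (toloc 1) mul.
Proof.
by elim/quotW=> x; rewrite !piE; apply: eq_pi => /=; ring.
Qed.

Lemma mul_addl : left_distributive mul add.
Proof.
elim/quotW=> x; elim/quotW=> y; elim/quotW=> z; rewrite !piE.
by apply: eq_pi => /=; ring.
Qed.

HB.instance Definition _ :=
  GRing.Zmodule_isComPzRing.Build type mulA mulC mul1_l mul_addl.

Lemma toloc_zmod_morphism : zmod_morphism toloc.
Proof.
move=> a b; rewrite -[RHS]/(add (toloc a) (opp (toloc b))) !piE.
by apply: eq_pi => /=; ring.
Qed.
HB.instance Definition _ :=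
  GRing.isZmodMorphism.Build R type toloc toloc_zmod_morphism.

Lemma toloc_monoid_morphism : monoid_morphism toloc.
Proof.
split=> [//|a b]; rewrite -[RHS]/(mul (toloc a) (toloc b)) !piE.
by apply: eq_pi => /=; ring.
Qed.
HB.instance Definition _ :=
  GRing.isMonoidMorphism.Build R type toloc toloc_monoid_morphism.

End Localization.
End Localization.
HB.export Localization.

Section PrimeLocalization.
Variables (S : comNzRingType) (P : prime_idealr S).

Definition prime_compl : {pred S} := fun x => x \notin P.

Lemma prime_compl_mulr_closed : mulr_closed prime_compl.
Proof.
split=> [|x y xP yP]; first by rewrite unfold_in /= idealr1.
by rewrite unfold_in /= prime_idealrM negb_or; apply/andP.
Qed.
HB.instance Definition _ :=
  GRing.isMulClosed.Build S prime_compl prime_compl_mulr_closed.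

Definition prime_loc : comPzRingType := Localization.type prime_compl.

Definition to_prime_loc : {rmorphism S -> prime_loc} :=
  @Localization.toloc S prime_compl.

End PrimeLocalization.

(* Ideals need not be proper here, unlike in mathcomp's idealr_closed;
   prime_idealr does require properness, as it should. *)
Definition is_ideal (R : comPzRingType) (I : set R) : Prop :=
  @GRing.submod_closed R R^o (mem I).

Definition ideal_gen (R : comPzRingType) (A : set R) : set R :=
  smallest (@is_ideal R) A.

Definition ideal_mul (R : comPzRingType) (I J : set R) : set R :=
  ideal_gen [set x * y | x in I & y in J].

Definition ideal_exp (R : comPzRingType) (I : set R) (n : nat) : set R :=
  iter n (ideal_mul I) [set: R].

Definition noetherian (R : comPzRingType) : Prop :=
  forall I : set R, is_ideal I -> exists s : seq R, I = ideal_gen [set` s].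

(* Ass(I) is the set of associated primes of the module S / I, that is the
   primes of the form (I : x), the annihilator of the class of x. *)
Definition associated_prime (S : comNzRingType) (I : set S)
    (P : prime_idealr S) : Prop :=
  exists x : S, [set a | a \in P] = [set a | I (a * x)].

(* J S_P \cap S, where "\cap S" is the preimage under S -> S_P *)
Definition loc_contraction (S : comNzRingType) (P : prime_idealr S)
    (J : set S) : set S :=
  to_prime_loc P @^-1` ideal_gen (to_prime_loc P @` J).

(* the intersection over Ass(I); prime_idealr S lies in too large a universe
   for \bigcap *)
Definition symbolic_power (S : comNzRingType) (I : set S) (s : nat) : set S :=
  [set x | forall P : prime_idealr S, associated_prime I P ->
             loc_contraction P (ideal_exp I s) x].

Definition symbolic_rees (S : comNzRingType) (I : set S) : set {poly S} :=
  [set f : {poly S} | forall m : nat, symbolic_power I m f`_m].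

Definition subalg_gen (S : comNzRingType) (A : set {poly S}) : set {poly S} :=
  smallest (fun B : set {poly S} => GRing.subalg_closed (mem B)) A.

(* The supremum is taken in the extended reals: it may be +oo, and it is -oo
   when the set is empty. *)
Definition resurgence (R : realType) (S : comNzRingType) (I : set S) : \bar R :=
  ereal_sup [set r | exists s t : nat, [/\ (0 < s)%N, (0 < t)%N,
    ~ symbolic_power I s `<=` ideal_exp I t & r = (s%:R / t%:R)%:E]].

(* Main.v *)
Require Import Defs.
From mathcomp Require Import all_boot all_order all_algebra.
From mathcomp Require Import zify.
From mathcomp Require Import all_classical all_reals ereal.

Set Implicit Arguments.
Unset Strict Implicit.
Unset Printing Implicit Defensive.

(** Write J for the symbolic power I^(n) and N = n (k + 1). The theorem
    comes from the single containment
      I^(m) <= I^(m - c)   whenever m <= N c                             [*]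
    (symbolic power on the left, ordinary power on the right).

    The hypothesis on the symbolic Rees algebra describes its degree m part:
    I^(m) lies in the ideal generated by the products J^j I^(m - n j) with
    n j <= m ([symbolic_power_sub_hybrid]). So one must measure how far J^j is
    from I^(n j). One factor J costs one power of I, since J <= P^k I^(n - 1),
    but it also supplies P^k, and P J <= I^n allows each of the k factors P to
    turn another J into I^n at no cost. So a batch of up to k + 1
    factors J costs one power of I ([exp_batch]), and (k + 1) c
    factors cost at most c powers ([exp_batches]); this is [*].

    The first assertion is [*] with m = N q and c = q. For the second, if
    s / t > N / (N - 1), then s < N (s - t), so [*] with m = s and c = s - t
    gives I^(s) <= I^t: such a pair (s, t) does not enter the supremum. *)

Import Order.TTheory GRing.Theory Num.Theory.
Local Open Scope classical_set_scope.
Local Open Scope ring_scope.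

(** * Products and powers of ideals *)

Section Ideals.
Context {R : comPzRingType}.
Implicit Types (A B C I J K : set R) (m n i j : nat) (x y : R).

Lemma is_idealE K : is_ideal K <->
  [/\ K 0, forall x y, K x -> K y -> K (x + y) & forall a x, K x -> K (a * x)].
Proof.
split=> [[K0 KL]|[K0 KD KM]]; last first.
  split; first by rewrite inE.
  by move=> a x y; rewrite !inE => Kx Ky; apply: KD => //; apply: KM.
rewrite inE in K0.
have KL' a x y : K x -> K y -> K (a * x + y).
  by move=> Kx Ky; have := KL a x y; rewrite !inE; apply.
split=> // [x y Kx Ky|a x Kx]; first by rewrite -[x]mul1r; apply: KL'.
by rewrite -[_ * _]addr0; apply: KL'.
Qed.

Lemma is_idealT : is_ideal [set: R].
Proof. exact/is_idealE. Qed.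

Lemma ideal_gen_ideal A : is_ideal (ideal_gen A).
Proof.
apply/is_idealE; split=> [|x y Ax Ay|a x Ax] K [idK AK];
  case/is_idealE: (idK) => K0 KD KM //.
  by apply: KD; [apply: Ax|apply: Ay].
by apply: KM; apply: Ax.
Qed.
Hint Resolve ideal_gen_ideal is_idealT : core.

Lemma sub_ideal_gen A : A `<=` ideal_gen A.
Proof. exact: sub_smallest. Qed.

Lemma ideal_gen_sub A K : is_ideal K -> A `<=` K -> ideal_gen A `<=` K.
Proof. by move=> idK AK; apply: smallest_sub. Qed.

Lemma ideal0 {K} : is_ideal K -> K 0.
Proof. by case/is_idealE. Qed.

Lemma idealD {K} x y : is_ideal K -> K x -> K y -> K (x + y).
Proof. by case/is_idealE=> _ KD _; apply: KD. Qed.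

Lemma idealMl {K} a x : is_ideal K -> K x -> K (a * x).
Proof. by case/is_idealE=> _ _; apply. Qed.

Lemma ideal_colon K y : is_ideal K -> is_ideal [set x | K (x * y)].
Proof.
move=> idK; apply/is_idealE; split=> /= [|x z Kx Kz|a x Kx].
- by rewrite mul0r; apply: ideal0.
- by rewrite mulrDl; apply: idealD.
- by rewrite -mulrA; apply: idealMl.
Qed.

(** The x with x y in K form an ideal ([ideal_colon]), so whether products lie
    in K can be checked on generators, one factor at a time. *)
Lemma ideal_gen_mul A K y : is_ideal K ->
  (forall x, A x -> K (x * y)) -> forall x, ideal_gen A x -> K (x * y).
Proof. by move=> idK AK; apply: ideal_gen_sub => //; apply: ideal_colon. Qed.

Lemma ideal_gen_mul2 A B K : is_ideal K ->
  (forall x y, A x -> B y -> K (x * y)) ->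
  forall x y, ideal_gen A x -> ideal_gen B y -> K (x * y).
Proof.
move=> idK ABK x y Ax By; move: x Ax; apply: ideal_gen_mul => // x Ax.
rewrite mulrC; move: y By; apply: ideal_gen_mul => // y By.
by rewrite mulrC; apply: ABK.
Qed.

Lemma ideal_mul_ideal A B : is_ideal (ideal_mul A B).
Proof. exact: ideal_gen_ideal. Qed.

Lemma mem_ideal_mul A B x y : A x -> B y -> ideal_mul A B (x * y).
Proof. by move=> Ax By; apply: sub_ideal_gen; exists x => //; exists y. Qed.

Lemma ideal_mul_sub A B K : is_ideal K ->
  (forall x y, A x -> B y -> K (x * y)) -> ideal_mul A B `<=` K.
Proof.
by move=> idK ABK; apply: ideal_gen_sub => // _ [x Ax [y By <-]]; apply: ABK.
Qed.

Lemma ideal_mulS A B A' B' : A `<=` A' -> B `<=` B' ->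
  ideal_mul A B `<=` ideal_mul A' B'.
Proof.
move=> AA' BB'; apply: ideal_mul_sub; first exact: ideal_mul_ideal.
by move=> x y Ax By; apply: mem_ideal_mul; [apply: AA'|apply: BB'].
Qed.

Lemma ideal_mulC A B : ideal_mul A B = ideal_mul B A.
Proof.
suff sub C D : ideal_mul C D `<=` ideal_mul D C by apply/seteqP; split.
apply: ideal_mul_sub; first exact: ideal_mul_ideal.
by move=> x y Cx Dy; rewrite mulrC; apply: mem_ideal_mul.
Qed.

Lemma ideal_mulA A B C :
  ideal_mul A (ideal_mul B C) = ideal_mul (ideal_mul A B) C.
Proof.
have sub (D E F : set R) :
    ideal_mul D (ideal_mul E F) `<=` ideal_mul (ideal_mul D E) F.
  apply: ideal_mul_sub; first exact: ideal_mul_ideal.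
  move=> x y Dx; rewrite mulrC; move: y.
  apply: ideal_gen_mul; first exact: ideal_mul_ideal.
  move=> _ [y Ey [z Fz <-]]; rewrite mulrC mulrA.
  by apply: mem_ideal_mul => //; apply: mem_ideal_mul.
apply/seteqP; split; first exact: sub.
rewrite ideal_mulC (ideal_mulC A B) (ideal_mulC A) (ideal_mulC B C).
exact: sub.
Qed.

Lemma ideal_mul1 K : is_ideal K -> ideal_mul [set: R] K = K.
Proof.
move=> idK; apply/seteqP; split.
  by apply: ideal_mul_sub => // x y _; apply: idealMl.
by move=> x Kx; rewrite -[x]mul1r; apply: mem_ideal_mul.
Qed.

Lemma ideal_mul_subr A K : is_ideal K -> ideal_mul A K `<=` K.
Proof. by move=> idK; apply: ideal_mul_sub => // x y _; apply: idealMl. Qed.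

Lemma ideal_exp_ideal A n : is_ideal (ideal_exp A n).
Proof. by case: n => [|n] //; apply: ideal_mul_ideal. Qed.
Hint Resolve ideal_exp_ideal : core.

Lemma ideal_expS A n : ideal_exp A n.+1 = ideal_mul A (ideal_exp A n).
Proof. by []. Qed.

Lemma sub_ideal_exp1 A : A `<=` ideal_exp A 1.
Proof. by move=> x Ax; rewrite -[x]mulr1; apply: mem_ideal_mul. Qed.

Lemma ideal_expD A m n :
  ideal_exp A (m + n) = ideal_mul (ideal_exp A m) (ideal_exp A n).
Proof.
elim: m => [|m IHm]; first by rewrite ideal_mul1.
by rewrite addSn !ideal_expS IHm ideal_mulA.
Qed.

Lemma ideal_exp_anti A m n : (m <= n)%N -> ideal_exp A n `<=` ideal_exp A m.
Proof. by move=> /subnK <-; rewrite ideal_expD; apply: ideal_mul_subr. Qed.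

Lemma ideal_exp_mono A B n : A `<=` B -> ideal_exp A n `<=` ideal_exp B n.
Proof. by move=> AB; elim: n => [//|n IHn]; apply: ideal_mulS. Qed.

Lemma ideal_exp_mulS A B C m n i : (i <= m + n)%N ->
  A `<=` ideal_exp C m -> B `<=` ideal_exp C n ->
  ideal_mul A B `<=` ideal_exp C i.
Proof.
move=> le_i AC BC; apply: subset_trans (ideal_exp_anti le_i).
by rewrite ideal_expD; apply: ideal_mulS.
Qed.

Lemma ideal_exp_mul A B n :
  ideal_exp (ideal_mul A B) n = ideal_mul (ideal_exp A n) (ideal_exp B n).
Proof.
elim: n => [|n IHn]; first by rewrite ideal_mul1.
rewrite !ideal_expS IHn -!ideal_mulA; congr ideal_mul.
by rewrite !ideal_mulA (ideal_mulC B).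
Qed.

Lemma ideal_exp_exp A m n : ideal_exp (ideal_exp A m) n = ideal_exp A (m * n).
Proof.
by elim: n => [|n IHn]; rewrite ?muln0 // mulnS ideal_expD -IHn.
Qed.

(** * Cost of a power of J in powers of I *)

(** One factor J is traded for P^k I^(n - 1), which loses a single power of I;
    each of the other b - 1 <= k factors then pairs with a factor P, and
    P J <= I^n loses nothing. *)
Lemma exp_batch I J P n k b :
  ideal_mul P J `<=` ideal_exp I n ->
  J `<=` ideal_mul (ideal_exp P k) (ideal_exp I (n - 1)) ->
  (b <= k.+1)%N -> ideal_exp J b `<=` ideal_exp I (n * b - 1).
Proof.
move=> PJ JP; case: b => [|i]; rewrite ?muln0 // ltnS => le_ik.
rewrite ideal_expS.
apply: (subset_trans (ideal_mulS JP (@subset_refl _ (ideal_exp J i)))).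
rewrite (ideal_mulC (ideal_exp P k)) -ideal_mulA.
apply: (@ideal_exp_mulS _ _ _ (n - 1) (n * i)) => //.
  by rewrite mulnS; lia.
(* Only i of the k factors P are used, one for each remaining factor J. *)
apply: (subset_trans (ideal_mulS (ideal_exp_anti le_ik) (@subset_refl _ _))).
by rewrite -ideal_exp_mul -ideal_exp_exp; apply: ideal_exp_mono.
Qed.

(** The induction takes off one batch of k + 1 factors at a time, the last one
    possibly incomplete. Truncated subtraction is harmless: its value 0 stands
    for the power 0, which is the whole ring. *)
Lemma exp_batches I J n k :
  (forall b, (b <= k.+1)%N -> ideal_exp J b `<=` ideal_exp I (n * b - 1)) ->
  forall c j, (j <= k.+1 * c)%N -> ideal_exp J j `<=` ideal_exp I (n * j - c).
Proof.
move=> batch; elim=> [|c IHc] j.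
  by rewrite muln0 leqn0 => /eqP->; rewrite muln0.
rewrite mulnS => le_j; set b := minn j k.+1.
have le_bj : (b <= j)%N by rewrite geq_minl.
rewrite -{1}(subnKC le_bj) ideal_expD.
apply: (@ideal_exp_mulS _ _ _ (n * b - 1) (n * (j - b) - c)).
- have : (n * b <= n * j)%N by rewrite leq_mul2l le_bj orbT.
  by rewrite mulnBr; lia.
- by apply: batch; rewrite geq_minr.
- by apply: IHc; rewrite /b; lia.
Qed.

End Ideals.
#[local] Hint Resolve ideal_gen_ideal ideal_exp_ideal : core.

(** * Degree components of the symbolic Rees algebra *)

Section Rees.
Context {S : comNzRingType}.
Implicit Types (I J : set S) (K : nat -> set S) (m n j : nat).

(** Polynomials whose coefficients lie in a multiplicative family of ideals
    form a subalgebra, so the family bounds the coefficients of a subalgebra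
    as soon as it bounds those of its generators. *)
Lemma subalg_gen_coef K (A : set {poly S}) :
  (forall m, is_ideal (K m)) -> K 0%N 1 ->
  (forall i j x y, K i x -> K j y -> K (i + j)%N (x * y)) ->
  (forall f, A f -> forall m, K m f`_m) ->
  forall f, subalg_gen A f -> forall m, K m f`_m.
Proof.
move=> idK K1 KM AK f fA.
apply: (fA [set g : {poly S} | forall m, K m g`_m]); split; last exact: AK.
split=> [|a u v|u v]; rewrite !inE /=.
- by move=> m; rewrite coef1; case: m => [//|m]; exact: ideal0 (idK _).
- move=> Ku Kv m; rewrite coefD coefZ.
  by apply: (idealD (idK m)) => //; apply: (idealMl _ (idK m)).
- move=> Ku Kv m; rewrite coefM.
  apply: (big_ind (K m)) => [|x y|i _]; first exact: ideal0 (idK m).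
    exact: idealD (idK m).
  by rewrite -[m in K m](subnKC (leq_ord i)); apply: KM.
Qed.

(** The degree m component of S[It, Jt^n]. *)
Definition hybrid I J n m : set S :=
  ideal_gen [set x | exists2 j, (n * j <= m)%N &
                     ideal_mul (ideal_exp J j) (ideal_exp I (m - n * j)) x].

Lemma hybrid_ideal I J n m : is_ideal (hybrid I J n m).
Proof. exact: ideal_gen_ideal. Qed.

Lemma hybridM I J n i j x y :
  hybrid I J n i x -> hybrid I J n j y -> hybrid I J n (i + j) (x * y).
Proof.
apply: ideal_gen_mul2 => [|{}x {}y [a le_ai ax] [b le_bj bY]].
  exact: hybrid_ideal.
apply: sub_ideal_gen; exists (a + b)%N; first by rewrite mulnDr leq_add.
have -> : (i + j - n * (a + b) = (i - n * a) + (j - n * b))%N.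
  by rewrite mulnDr; lia.
rewrite !ideal_expD ideal_mulA -(ideal_mulA (ideal_exp J a)).
rewrite (ideal_mulC (ideal_exp J b)) ideal_mulA -ideal_mulA.
exact: mem_ideal_mul.
Qed.

Lemma hybrid0 I J n : hybrid I J n 0 1.
Proof.
apply: sub_ideal_gen; exists 0%N; rewrite muln0 //.
by rewrite -[1]mulr1; apply: mem_ideal_mul.
Qed.

Lemma sub_hybrid1 I J n : I `<=` hybrid I J n 1.
Proof.
move=> x Ix; apply: sub_ideal_gen; exists 0%N; rewrite muln0 // subn0.
by rewrite -[x]mul1r; apply: mem_ideal_mul => //; apply: sub_ideal_exp1.
Qed.

Lemma sub_hybridn I J n : J `<=` hybrid I J n n.
Proof.
move=> x Jx; apply: sub_ideal_gen; exists 1%N; rewrite muln1 // subnn.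
by rewrite -[x]mulr1; apply: mem_ideal_mul => //; apply: sub_ideal_exp1.
Qed.

Lemma symbolic_power0 I m : symbolic_power I m 0.
Proof.
by move=> Q _; rewrite /loc_contraction /= rmorph0; apply: ideal0.
Qed.

(** An element x of I^(m) enters the symbolic Rees algebra as the monomial x t^m,
    and the hybrid ideals bound the coefficients of the generators I t and
    I^(n) t^n, hence those of every element of that algebra. *)
Lemma symbolic_power_sub_hybrid I n :
  symbolic_rees I = subalg_gen ([set a *: 'X | a in I] `|`
                                [set b *: 'X^n | b in symbolic_power I n]) ->
  forall m, symbolic_power I m `<=` hybrid I (symbolic_power I n) n m.
Proof.
move=> gen m x Ix.
have : symbolic_rees I (x *: 'X^m).
  move=> i; rewrite coefZ coefXn; case: eqP => [->|_]; first by rewrite mulr1.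
  by rewrite mulr0; apply: symbolic_power0.
have xE : x = (x *: 'X^m)`_m by rewrite coefZ coefXn eqxx mulr1.
rewrite gen => xm; rewrite xE.
apply: (subalg_gen_coef (K := hybrid I (symbolic_power I n) n) _ _ _ _ xm).
- exact: hybrid_ideal.
- exact: hybrid0.
- exact: hybridM.
- move=> _ [[a Ia <-]|[b Ib <-]] i; rewrite coefZ ?coefX ?coefXn.
  + case: eqP => [->|_]; first by rewrite mulr1; apply: sub_hybrid1.
    by rewrite mulr0; exact: ideal0 (hybrid_ideal _ _ _ _).
  + case: eqP => [->|_]; first by rewrite mulr1; apply: sub_hybridn.
    by rewrite mulr0; exact: ideal0 (hybrid_ideal _ _ _ _).
Qed.

Lemma hybrid_sub_exp I J n k m c : (0 < n)%N ->
  (forall j, (j <= k.+1 * c)%N -> ideal_exp J j `<=` ideal_exp I (n * j - c)) ->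
  (m <= n * (k.+1 * c))%N -> hybrid I J n m `<=` ideal_exp I (m - c).
Proof.
move=> n_gt0 Jexp le_m; apply: ideal_gen_sub => // x [j le_j].
have le_jc : (j <= k.+1 * c)%N by rewrite -(leq_pmul2l n_gt0) (leq_trans le_j).
by apply: (ideal_exp_mulS _ (Jexp _ le_jc) (@subset_refl _ _)); lia.
Qed.

End Rees.

(** * Resurgence *)

(** A pair (s, t) with s / t > N / (N - 1) satisfies s < N (s - t), so a
    containment with loss c as soon as s <= N c applies to it with c = s - t. *)
Lemma resurgence_le (R : realType) (S : comNzRingType) (I : set S) (N : nat) :
  (1 < N)%N ->
  (forall m c, (m <= N * c)%N ->
     symbolic_power I m `<=` ideal_exp I (m - c)) ->
  (resurgence R I <= (N%:R / (N%:R - 1))%:E)%E.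
Proof.
move=> N_gt1 sub; apply: ge_ereal_sup => _ [s [t [s_gt0 t_gt0 nsub ->]]].
have -> : N%:R - 1 = (N - 1)%:R :> R by rewrite natrB // ltnW.
rewrite lee_fin.
rewrite ler_pdivrMr ?ltr0n // mulrAC ler_pdivlMr ?ltr0n ?subn_gt0 //.
rewrite -!natrM ler_nat leqNgt; apply/negP => lt_st; apply: nsub.
have le_ts : (t <= s)%N by nia.
rewrite -(subKn le_ts); apply: sub; nia.
Qed.

Theorem theorem3p1 (R : realType) (S : comNzRingType) (S_noeth : noetherian S)
    (I : set S) (I_ideal : is_ideal I)
    (I_nonzero : I <> [set 0]) (I_proper : I <> [set: S])
    (n : nat) (n_ge2 : (2 <= n)%N)
    (rees_gen : symbolic_rees I =
       subalg_gen ([set a *: 'X | a in I] `|`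
                   [set b *: 'X^n | b in symbolic_power I n]))
    (P : set S) (P_ideal : is_ideal P) (k : nat) (k_ge1 : (1 <= k)%N)
    (P_mul : ideal_mul P (symbolic_power I n) `<=` ideal_exp I n)
    (P_exp : symbolic_power I n `<=`
       ideal_mul (ideal_exp P k) (ideal_exp I (n - 1)%N)) :
  (forall q : nat, (0 < q)%N ->
     symbolic_power I (n * k * q + n * q)%N `<=`
     ideal_exp I (n * k * q + n * q - q)%N) /\
  (resurgence R I <= ((n * k + n)%:R / ((n * k + n)%:R - 1))%:E)%E.
Proof.
have key m c : (m <= (n * k + n) * c)%N ->
    symbolic_power I m `<=` ideal_exp I (m - c).
  move=> le_m.
  apply: (subset_trans (@symbolic_power_sub_hybrid _ _ _ rees_gen m)).
  apply: (@hybrid_sub_exp _ _ _ _ k) => [|j le_j|]; first exact: ltnW.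
    by apply: exp_batches le_j => b; apply: exp_batch P_mul P_exp.
  by rewrite mulnA mulnS addnC.
split=> [q _|]; first by apply: key; rewrite mulnDl.
by apply: resurgence_le key; rewrite ltn_addl.
Qed.
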